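(* Let $p>0$, $k>p$ and $d\ge1$ be integers with $dk\ge 2p$, and let $\mu=[k^d]$ be the partition of $dk$ with $d$ parts all equal to $k$. Then, as polynomials in $x$, $$\binom{dk}{p}P^{\bullet}_{[p,dk-p],[k^d]}(x)=\sum_{i=0}^{p-1}\sum_{j=0}^{d}(-1)^{d-j}\binom{d}{j}\binom{x+i}{p}\binom{x+i-p+jk}{dk-p}.$$
   Context: $\mathfrak{S}_n$ is the symmetric group on $[n]=\{1,\ldots,n\}$; for $\lambda\vdash n$, $\mathcal{C}_\lambda\subset\mathfrak{S}_n$ is the conjugacy class of permutations of cycle-type $\lambda$; $[p,n-p]$ denotes the partition of $n$ with the two parts $p$ and $n-p$; $\kappa(\pi)$ is the number of cycles of $\pi$ (fixed points included). For a partition $\mu\vdash n$ and a fixed permutation $\gamma\in\mathfrak{S}_n$ of cycle-type $[p,n-p]$, $$P^{\bullet}_{[p,n-p],\mu}(x)=\frac{1}{|\mathcal{C}_\mu|}\sum_{\alpha\in\mathcal{C}_\mu,\ \langle\alpha,\gamma\rangle\text{ transitive on }[n]}x^{\kappa(\alpha\gamma)},$$ which does not depend on the choice of $\gamma$. $\binom{x}{m}=x(x-1)\cdots(x-m+1)/m!$ is regarded as a polynomial in $x$. *)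

(* Defs.v *)
From mathcomp Require Import all_boot all_order all_algebra all_fingroup.

Set Implicit Arguments.
Unset Strict Implicit.
Unset Printing Implicit Defensive.

Import GRing.Theory.
Local Open Scope ring_scope.

(* The sizes of all cycles of s, fixed points included. *)
Definition cycle_lengths (n : nat) (s : 'S_n) : seq nat :=
  [seq #|pred_of_set C| | C <- enum (porbits s)].

(* A partition is represented by the list of its parts, in any order. *)
Definition has_cycle_type (n : nat) (s : 'S_n) (lambda : seq nat) : bool :=
  perm_eq (cycle_lengths s) lambda.

Definition cycle_class (n : nat) (lambda : seq nat) : {set 'S_n} :=
  [set s : 'S_n | has_cycle_type s lambda].

Definition kappa (n : nat) (s : 'S_n) : nat := #|porbits s|.

Definition generates_transitive (n : nat) (alpha gamma : 'S_n) : bool :=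
  [transitive <<[set alpha; gamma]>>, on [set: 'I_n] | 'P].

(* The average runs over the whole class of mu; only the sum is restricted to
   transitive pairs. Products in 'S_n apply the left factor first; this does
   not affect kappa, alpha * gamma and gamma * alpha being conjugate. *)
Definition Pbullet (n : nat) (gamma : 'S_n) (mu : seq nat) : {poly rat} :=
  (#|cycle_class n mu|%:R)^-1 *:
    \sum_(alpha in cycle_class n mu | generates_transitive alpha gamma)
      'X^(kappa (alpha * gamma)%g).

(* binom_poly q m is the binomial coefficient "q choose m" of a polynomial q. *)
Definition binom_poly (q : {poly rat}) (m : nat) : {poly rat} :=
  (m`!%:R)^-1 *: \prod_(l < m) (q - l%:R).

(* Main.v *)
Require Import Defs.
From HB Require Import structures.
From mathcomp Require Import all_boot all_order all_algebra all_fingroup.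
From mathcomp Require Import ring zify.
From mathcomp Require Import bigenough ssrcomplements mpoly.

(** Both sides are polynomials in x, so it is enough to take x = m for every
integer m > n, where n = dk. Let X be an m x m matrix of indeterminates,
t_k = tr X^k, and let y_1, .., y_m be variables with power sums p_k and
Vandermonde determinant D.

Pairing monomials turns cycles of permutations into traces: for s, g in S_n of
cycle types mu and nu, the differential operator obtained from the product of
the t_(mu_i) by substituting d/dX_ij for X_ij, applied to the product of the
t_(nu_j), is the constant

   sum over u in S_n of m ^ kappa(s^-1 ^ u * g)        ([dop_trace_prod]).

This constant can be computed on diagonal matrices. If rho is the restriction
to diagonal matrices and f is a polynomial in the t_k, then

   D * rho (tr (d/dX)^k f) = sum_i (d/dy_i)^k (D * rho f)   ([radial_dop]),

a theorem of Harish-Chandra. For k = 2 it is a computation with the Laplacian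
tr (d/dX)^2, which rests on the harmonicity of D ([radial_lap]). The other
values of k follow because tr (d/dX)^k is, up to a scalar, the k-fold
commutator of that Laplacian with multiplication by t_k, while
sum_i (d/dy_i)^k is obtained in the same way from p_k ([dual_to]).

Let now mu = [k^d] and nu = [p, a] with a = n - p, and put
P = sum_i (d/dy_i)^k. The constant K above satisfies K * D = P^d (p_a p_p D).
Because p < k, P kills p_p D, so only iterated commutators survive:
P^d (p_a p_p D) = sum_l E_l (p_p D), where

   E_l = sum_j (-1)^(d-j) C(d, j) (d/dy_l)^(jk) y_l^a (d/dy_l)^((d-j)k)

([iter_dpow], [iter_ad_expand]). The operator E_l maps y_l^b to a multiple
w(b) of y_l^(b-p). Expanding D along its columns, all contributions cancel but
those of b = m, .., m + p - 1, so that K = sum_(i < p) w(m + i)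
([sum_lowers_powsum_vdm_eq]). For b >= n the ratio of factorials w(b) is the
alternating sum of the statement, up to the factor p! a! ([weight_large]).

Averaging over the class of [k^d] gives the theorem. The transitivity
condition is automatic: a cycle of length p of gamma is too short to be a
union of cycles of length k ([generates_transitive_nseq]). *)

Set Implicit Arguments.
Unset Strict Implicit.
Unset Printing Implicit Defensive.
Import BigEnough GRing.Theory Num.Theory.
Local Open Scope ring_scope.

(** * Polynomials as differential operators *)

Section DiffOp.
Variable n : nat.
Implicit Types q f : {mpoly rat[n]}.

(** The operator q(d/dX_1, .., d/dX_n) applied to f. *)
Definition dop f q : {mpoly rat[n]} := \sum_(m <- msupp q) q@_m *: f^`M[m].

Lemma dopwE f q k : (msize q <= k)%N ->
  dop f q = \sum_(m : 'X_{1..n < k}) q@_m *: f^`M[m].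
Proof.
pose I : subFinType _ := 'X_{1..n < k}.
move=> le_qk; rewrite /dop (big_mksub I) /=; first last.
- by move=> x /msize_mdeg_lt /leq_trans; apply.
- exact: msupp_uniq.
rewrite big_rmcond //= => i.
by move/memN_msupp_eq0 ->; rewrite scale0r.
Qed.

Lemma dop_is_linear f : linear (dop f).
Proof.
move=> c q r; pose_big_enough j; first rewrite !(@dopwE _ _ j) //.
  rewrite scaler_sumr -big_split /=; apply/eq_bigr=> m _.
  by rewrite mcoeffD mcoeffZ scalerDl scalerA.
by close.
Qed.

HB.instance Definition _ f := GRing.isLinear.Build rat {mpoly rat[n]}
  {mpoly rat[n]} _ (dop f) (dop_is_linear f).

Lemma dopXm f m : dop f 'X_[m] = f^`M[m].
Proof. by rewrite /dop msuppX big_seq1 mcoeffX eqxx scale1r. Qed.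

Lemma dopX f i : dop f 'X_i = f^`M(i).
Proof. by rewrite dopXm mderivmU1m. Qed.

Lemma dop1 f : dop f 1 = f.
Proof. by rewrite -(mpolyX0 n rat) dopXm mderivm0m. Qed.

(** Constant-coefficient operators commute, and the product of polynomials
becomes composition. *)
Lemma dopM f q r : dop f (q * r) = dop (dop f q) r.
Proof.
rewrite [r]mpolyE mulr_sumr !linear_sum /=; apply: eq_bigr => m _.
rewrite -scalerAr !linearZ /= dopXm; congr (_ *: _).
rewrite {1}[q]mpolyE mulr_suml linear_sum /= [in RHS]/dop linear_sum /=.
apply: eq_bigr => m' _; rewrite -scalerAl linearZ /= -mpolyXD dopXm.
by rewrite mderivmDm linearZ.
Qed.

End DiffOp.

(** * Laplacians and iterated commutators *)

Definition ad (V : zmodType) (L A : V -> V) : V -> V :=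
  fun f => L (A f) - A (L f).

Lemma adE (V : zmodType) (L A : V -> V) f : ad L A f = L (A f) - A (L f).
Proof. by []. Qed.

Lemma eq_ad (V : zmodType) (L A B : V -> V) :
  A =1 B -> ad L A =1 ad L B.
Proof. by move=> eqAB f; rewrite /ad !eqAB. Qed.

Section Laplacian.
Variables (n : nat) (tau : 'I_n -> 'I_n).
Hypothesis tauK : involutive tau.
Implicit Types f g q : {mpoly rat[n]}.

(** A Laplacian twisted by an involution of the variables: for the transposition
of matrix entries this is tr (d/dX)^2, and for the identity it is the usual
Laplacian. [grad_form] is its carre du champ, the obstruction to the Leibniz
rule. *)
Definition lap f : {mpoly rat[n]} := \sum_i f^`M(i)^`M(tau i).
Definition grad_form f g : {mpoly rat[n]} := \sum_i f^`M(i) * g^`M(tau i).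

Lemma lap_is_linear : linear lap.
Proof.
move=> c f g; rewrite /lap scaler_sumr -big_split /=; apply: eq_bigr => i _.
by rewrite !linearP.
Qed.
HB.instance Definition _ := GRing.isLinear.Build rat {mpoly rat[n]}
  {mpoly rat[n]} _ lap lap_is_linear.

Lemma grad_form_is_linear f : linear (grad_form f).
Proof.
move=> c g h; rewrite /grad_form scaler_sumr -big_split /=; apply: eq_bigr => i _.
by rewrite !linearP /= mulrDr scalerAr.
Qed.
HB.instance Definition _ f := GRing.isLinear.Build rat {mpoly rat[n]}
  {mpoly rat[n]} _ (grad_form f) (grad_form_is_linear f).

Lemma grad_formM f g h : grad_form f (g * h) = g * grad_form f h + grad_form f g * h.
Proof.
rewrite /grad_form mulr_sumr mulr_suml -big_split /=; apply: eq_bigr => i _.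
by rewrite mderivM; ring.
Qed.

Lemma lapM f g : lap (f * g) = f * lap g + lap f * g + 2%:R * grad_form f g.
Proof.
have gamE: grad_form f g = \sum_i f^`M(tau i) * g^`M(i).
  rewrite /grad_form (reindex_inj (inv_inj tauK)) /=.
  by apply: eq_bigr => i _; rewrite tauK.
rewrite mulr_natl mulr2n {2}gamE /lap /grad_form mulr_sumr mulr_suml -!big_split /=.
by apply: eq_bigr => i _; rewrite mderivM mderivD !mderivM; ring.
Qed.

Lemma mderivU i j : ('X_i : {mpoly rat[n]})^`M(j) = (i == j)%:R.
Proof.
rewrite mderivX mnm1E; case: eqVneq => [->|_]; last by rewrite scale0r.
rewrite scale1r (_ : (U_(j) - U_(j))%MM = 0%MM) ?mpolyX0 //.
by apply/mnmP => l; rewrite mnmBE subnn mnm0E.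
Qed.

Lemma grad_form_var i f : grad_form 'X_i f = f^`M(tau i).
Proof.
rewrite /grad_form (bigD1 i) //= mderivU eqxx mul1r big1 ?addr0 // => j jNi.
by rewrite mderivU eq_sym (negPf jNi) mul0r.
Qed.

Lemma lap_var i : lap 'X_i = 0.
Proof.
apply: big1 => j _; rewrite mderivU -[_%:R]/((_ == _)%:R).
by case: (i == j); rewrite ?raddf0 // -[1%:R]/(1%:MP) mderivC.
Qed.

Lemma lap_varM i f : lap ('X_i * f) = 'X_i * lap f + 2%:R * f^`M(tau i).
Proof. by rewrite lapM lap_var mul0r addr0 grad_form_var. Qed.

Lemma mderiv_lap i f : (lap f)^`M(i) = lap f^`M(i).
Proof.
rewrite /lap raddf_sum; apply: eq_bigr => j _ /=.
by rewrite mderiv_comm (mderiv_comm j).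
Qed.

(** Leibniz rule for the iterated commutator: it stops after two terms because
the commutator of [lap] with a variable is twice a derivative, which commutes
with [lap]. *)
Lemma iter_ad_varM i (A : {mpoly rat[n]} -> {mpoly rat[n]}) j f :
  iter j (ad lap) (fun g => 'X_i * A g) f =
  'X_i * iter j (ad lap) A f + (iter j.-1 (ad lap) A f)^`M(tau i) *+ (2 * j).
Proof.
elim: j f => [|j IH] f; first by rewrite muln0 mulr0n addr0.
have ->: iter j.+1 (ad lap) (fun g => 'X_i * A g) f =
   ad lap (fun g => 'X_i * iter j (ad lap) A g +
     (iter j.-1 (ad lap) A g)^`M(tau i) *+ (2 * j)) f.
  exact: (eq_ad _ IH).
have E g : (iter j (ad lap) A g)^`M(tau i) *+ (2 * j) =
    (lap (iter j.-1 (ad lap) A g))^`M(tau i) *+ (2 * j) -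
    (iter j.-1 (ad lap) A (lap g))^`M(tau i) *+ (2 * j).
  by case: j {IH} => [|j]; rewrite ?muln0 ?mulr0n ?subrr // -mulrnBl -raddfB.
rewrite iterS !adE linearD /= lap_varM linearMn /= -mderiv_lap.
rewrite mulnSr [X in _ = _ + X]mulrnDr E mulr_natl mulrBr; ring.
Qed.

Lemma iter_ad0 j f : iter j (ad lap) (fun=> 0) f = 0.
Proof.
by elim: j f => //= j IH f; rewrite /ad !IH raddf0 subr0.
Qed.

Lemma eq_iter_ad j (A B : {mpoly rat[n]} -> {mpoly rat[n]}) :
  A =1 B -> iter j (ad lap) A =1 iter j (ad lap) B.
Proof. by move=> eqAB; elim: j => //= j IH; apply: eq_ad. Qed.

(** For q homogeneous of degree k, the k-fold commutator of the Laplacian with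
multiplication by q is the operator q' obtained from q by applying [tau] to
the variables, up to the scalar 2^k k!. The vanishing of the next commutator
is part of the definition so that degrees can be added one variable at a
time. *)
Definition dual_to k q q' := forall f,
  iter k (ad lap) ( *%R q) f = dop f q' *+ (2 ^ k * k`!) /\
  iter k.+1 (ad lap) ( *%R q) f = 0.

Lemma dual_to1 : dual_to 0 1 1.
Proof. by move=> f; rewrite /= /ad dop1 !mul1r subrr. Qed.

Lemma dual_toX k i q q' :
  dual_to k q q' -> dual_to k.+1 ('X_i * q) ('X_(tau i) * q').
Proof.
move=> dq f.
have eqM j : iter j (ad lap) ( *%R ('X_i * q)) f =
    iter j (ad lap) (fun g => 'X_i * (q * g)) f.
  by apply: eq_iter_ad => g; rewrite mulrA.
rewrite !eqM !iter_ad_varM (dq f).2 mulr0 add0r; split.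
  rewrite (dq f).1 raddfMn /= mulrC dopM dopX -mulrnA; congr (_ *+ _).
  by rewrite expnS factS; ring.
rewrite iterS (eq_ad _ (fun g => (dq g).2)) -[ad _ _ _]/(iter 1 _ _ _).
by rewrite iter_ad0 linear0 mulr0 mul0rn addr0.
Qed.

Lemma dual_toD k q q' r r' :
  dual_to k q q' -> dual_to k r r' -> dual_to k (q + r) (q' + r').
Proof.
move=> dq dr f.
have adD j (A B : {mpoly rat[n]} -> {mpoly rat[n]}) g :
    iter j (ad lap) (fun h => A h + B h) g =
    iter j (ad lap) A g + iter j (ad lap) B g.
  elim: j g => //= j IH g; rewrite (eq_ad _ IH) /ad linearD /=; ring.
have eqM j : iter j (ad lap) ( *%R (q + r)) f =
    iter j (ad lap) (fun g => q * g + r * g) f.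
  by apply: eq_iter_ad => g; rewrite mulrDl.
by rewrite !eqM !adD (dq f).1 (dq f).2 (dr f).1 (dr f).2 linearD mulrnDl addr0.
Qed.

Lemma dual_to0 k : dual_to k 0 0.
Proof.
move=> f.
have eqM j : iter j (ad lap) ( *%R 0) f = iter j (ad lap) (fun=> 0) f.
  by apply: eq_iter_ad => g; rewrite mul0r.
by rewrite !eqM !iter_ad0 linear0 mul0rn.
Qed.

Lemma dual_to_sum k (I : Type) (r : seq I) (P : pred I) (F F' : I -> {mpoly rat[n]}) :
  (forall i, P i -> dual_to k (F i) (F' i)) ->
  dual_to k (\sum_(i <- r | P i) F i) (\sum_(i <- r | P i) F' i).
Proof.
by move=> dF; elim/big_ind2: _ => // *; [exact: dual_to0 | exact: dual_toD].
Qed.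

End Laplacian.

(** * Traces of powers of the generic matrix *)

Section MatrixTraces.
Variable m' : nat.
Local Notation m := m'.+1.
Local Notation N := #|{: 'I_m * 'I_m}|.

(** The entries of an m x m matrix are numbered through the enumeration of pairs
of indices. *)
Definition entry (i j : 'I_m) : 'I_N := enum_rank (i, j).
Definition entry_tr (k : 'I_N) : 'I_N :=
  entry (enum_val k).2 (enum_val k).1.

Lemma entry_trE i j : entry_tr (entry i j) = entry j i.
Proof. by rewrite /entry_tr /entry enum_rankK. Qed.

Lemma entry_trK : involutive entry_tr.
Proof.
by move=> k; rewrite {2}/entry_tr entry_trE /entry -surjective_pairing enum_valK.
Qed.

Lemma sum_entry (V : nmodType) (F : 'I_N -> V) :
  \sum_k F k = \sum_i \sum_j F (entry i j).
Proof.
rewrite pair_big /= (reindex (@enum_rank _)) /=.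
  by apply: eq_bigr => -[i j].
by exists enum_val => k _; rewrite ?enum_rankK ?enum_valK.
Qed.

Lemma entry_eq i j i' j' : (entry i j == entry i' j') = (i == i') && (j == j').
Proof. by rewrite /entry (inj_eq enum_rank_inj). Qed.

Definition gen_mx : 'M[{mpoly rat[N]}]_m := \matrix_(i, j) 'X_(entry i j).
Definition tr_pow k : {mpoly rat[N]} := \tr (gen_mx ^+ k).

Lemma mderiv_mulmx c (A B : 'M[{mpoly rat[N]}]_m) :
  map_mx (mderiv c) (A * B) = map_mx (mderiv c) A * B + A * map_mx (mderiv c) B.
Proof.
apply/matrixP => i j; rewrite !mxE raddf_sum -big_split /=.
by apply: eq_bigr => k _; rewrite mderivM !mxE.
Qed.

Lemma mderiv_gen_mx i j : map_mx (mderiv (entry i j)) gen_mx = delta_mx i j.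
Proof.
by apply/matrixP => k l; rewrite !mxE mderivU entry_eq (eq_sym k) (eq_sym l).
Qed.

Lemma mderiv_gen_mx_exp c k : map_mx (mderiv c) (gen_mx ^+ k) =
  \sum_(b < k) gen_mx ^+ b * map_mx (mderiv c) gen_mx * gen_mx ^+ (k.-1 - b).
Proof.
elim: k => [|k IH].
  rewrite big_ord0; apply/matrixP => i j; rewrite !mxE.
  by case: (i == j); rewrite ?raddf0 // -[1%:R]/(1%:MP) mderivC.
rewrite exprS mderiv_mulmx IH big_ord_recl expr0 mul1r subn0; congr (_ + _).
rewrite mulr_sumr; apply: eq_bigr => b _.
rewrite !mulrA -exprS lift0 /=; congr (_ * _ ^+ _).
by case: k b {IH} => [[]//|k] b; rewrite subSS.
Qed.

Lemma tr_mul_delta (A : 'M[{mpoly rat[N]}]_m) i j : \tr (A * delta_mx i j) = A j i.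
Proof.
rewrite /mxtrace (bigD1 j) //= big1 ?addr0 => [|l lj].
  rewrite mxE (bigD1 i) //= mxE !eqxx mulr1 big1 ?addr0 // => l li.
  by rewrite mxE (negPf li) mulr0.
by rewrite mxE big1 // => q _; rewrite mxE (negPf lj) andbF mulr0.
Qed.

Lemma mderiv_tr_pow i j k : (tr_pow k)^`M(entry i j) = (gen_mx ^+ k.-1) j i *+ k.
Proof.
have -> : (tr_pow k)^`M(entry i j) = \tr (map_mx (mderiv (entry i j)) (gen_mx ^+ k)).
  by rewrite /tr_pow /mxtrace raddf_sum; apply: eq_bigr => l _; rewrite mxE.
rewrite mderiv_gen_mx_exp raddf_sum /= -[X in _ *+ X](card_ord k) -sumr_const.
apply: eq_bigr => b _; rewrite mderiv_gen_mx mxtrace_mulC mulmxE mulrA -exprD.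
by rewrite subnK ?tr_mul_delta //; have := ltn_ord b; lia.
Qed.

Local Notation lapX := (lap entry_tr).
Local Notation gamX := (grad_form entry_tr).

(** The carre du champ joins two traces into one, and the Laplacian (below) cuts
one trace into two; both therefore preserve polynomials in traces. *)
Lemma grad_form_tr_pow k l : gamX (tr_pow k.+1) (tr_pow l.+1) = tr_pow (k + l) *+ (k.+1 * l.+1).
Proof.
rewrite /grad_form sum_entry [tr_pow (k + l)]/tr_pow exprD /mxtrace -sumrMnl exchange_big /=.
apply: eq_bigr => i _; rewrite mxE -sumrMnl; apply: eq_bigr => j _.
by rewrite entry_trE !mderiv_tr_pow /= mulrnAr mulrnAl -mulrnA.
Qed.

Lemma mderiv_gen_mx_exp_entry i j k :
  ((gen_mx ^+ k) i j)^`M(entry i j) = \sum_(b < k) (gen_mx ^+ b) i i * (gen_mx ^+ (k.-1 - b)) j j.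
Proof.
have -> : ((gen_mx ^+ k) i j)^`M(entry i j) = (map_mx (mderiv (entry i j)) (gen_mx ^+ k)) i j.
  by rewrite mxE.
rewrite mderiv_gen_mx_exp summxE; apply: eq_bigr => b _; rewrite mderiv_gen_mx.
rewrite mxE (bigD1 j) //= big1 ?addr0 => [|l lj].
  rewrite mxE (bigD1 i) //= mxE !eqxx mulr1 big1 ?addr0 // => l li.
  by rewrite mxE (negPf li) mulr0.
by rewrite mxE big1 ?mul0r // => q _; rewrite mxE (negPf lj) andbF mulr0.
Qed.

Lemma lap_tr_pow k : lapX (tr_pow k.+1) = (\sum_(b < k) tr_pow b * tr_pow (k.-1 - b)) *+ k.+1.
Proof.
have tE b c : tr_pow b * tr_pow c = \sum_i \sum_j (gen_mx ^+ b) i i * (gen_mx ^+ c) j j.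
  by rewrite /tr_pow /mxtrace mulr_suml; apply: eq_bigr => i _; rewrite mulr_sumr.
under [in RHS]eq_bigr do rewrite tE.
rewrite exchange_big /= /lap sum_entry exchange_big /= -sumrMnl.
apply: eq_bigr => i _; rewrite exchange_big /= -sumrMnl.
apply: eq_bigr => j _.
by rewrite entry_trE mderiv_tr_pow /= raddfMn /= mderiv_gen_mx_exp_entry.
Qed.

Lemma tr_pow0 : tr_pow 0 = m%:R.
Proof. by rewrite /tr_pow expr0 mxtrace1. Qed.

(** The twist by transposition is harmless: a matrix and its transpose have the
same traces of powers. *)
Lemma dual_to_tr_pow k : dual_to entry_tr k (tr_pow k) (tr_pow k).
Proof.
have tE : tr_pow k = \tr (gen_mx^T ^+ k).
  rewrite /tr_pow; suff -> : gen_mx^T ^+ k = (gen_mx ^+ k)^T by rewrite mxtrace_tr.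
  elim: k => [|k IH]; first by rewrite !expr0 trmx1.
  by rewrite exprS IH exprSr -!mulmxE trmx_mul.
rewrite {2}tE; apply: dual_to_sum => i _; move: {2 4}i => j {tE}.
elim: k i j => [|k IH] i j.
  rewrite !expr0 !mxE; case: (i == j); first exact: dual_to1.
  exact: dual_to0.
rewrite !exprS !mxE; apply: dual_to_sum => l _; rewrite !mxE.
by have := dual_toX entry_trK (entry i l) (IH l j); rewrite entry_trE.
Qed.

End MatrixTraces.

(** * Operators in one variable applied to the Vandermonde determinant *)

Lemma mderivX_exp n (i j : 'I_n) k :
  ('X_i ^+ k : {mpoly rat[n]})^`M(j) = 'X_i ^+ k.-1 *+ ((i == j) * k).
Proof.
case: k => [|k]; first by rewrite muln0 mulr0n expr0 -[1]/(1%:MP) mderivC.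
elim: k => [|k IH].
  by rewrite expr1 mderivU muln1 /= expr0.
rewrite exprS mderivM mderivU IH /=; case: (i == j) => /=.
  by rewrite mul1r !mul1n mulrnAr -exprS [RHS]mulrS.
by rewrite mul0r !mul0n !mulr0n mulr0 addr0.
Qed.

Lemma mderivn_freeM n (l : 'I_n) b k (c : {mpoly rat[n]}) : c^`M(l) = 0 ->
  ('X_l ^+ b * c)^`M(l, k) = (b ^_ k)%:R *: ('X_l ^+ (b - k) * c).
Proof.
move=> c0; elim: k => [|k IH]; first by rewrite mderivn0 subn0 scale1r.
rewrite mderivnS IH mderivZ mderivM c0 mulr0 addr0 mderivX_exp eqxx mul1n.
by rewrite subnS mulrnAl -scaler_nat scalerA ffactnSr natrM.
Qed.

Section Wedge.
Variable m : nat.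
Implicit Types (l : 'I_m) (c g : {mpoly rat[m]}).

Definition powsum k : {mpoly rat[m]} := \sum_i 'X_i ^+ k.
Definition vdm_mx : 'M[{mpoly rat[m]}]_m := Vandermonde m (\row_i 'X_i).
Definition vdm : {mpoly rat[m]} := \det vdm_mx.

Lemma vdm_mxE b l : vdm_mx b l = 'X_l ^+ b.
Proof. by rewrite !mxE. Qed.

(** Deleting the column of the variable y_l removes y_l altogether. *)
Lemma free_cofactor b l : (cofactor vdm_mx b l)^`M(l) = 0.
Proof.
rewrite expand_cofactor raddf_sum big1 // => s /eqP sbl /=.
have -> : (-1) ^+ s = ((-1) ^+ s)%:MP :> {mpoly rat[m]}.
  by rewrite rmorphXn rmorphN rmorph1.
rewrite mderiv_mulC.
suff -> : (\prod_(k | b != k) vdm_mx k (s k))^`M(l) = 0 by rewrite mulr0.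
elim/big_ind: _ => [|x y x0 y0|k bk].
- by rewrite -[1]/(1%:MP) mderivC.
- by rewrite mderivM x0 y0 mul0r mulr0 addr0.
rewrite vdm_mxE mderivX_exp -sbl (inj_eq perm_inj) eq_sym (negPf bk).
by rewrite mul0n mulr0n.
Qed.

Lemma vdm_expand l : vdm = \sum_(b < m) 'X_l ^+ b * cofactor vdm_mx b l.
Proof.
by rewrite /vdm (expand_det_col _ l); apply: eq_bigr => b _; rewrite vdm_mxE.
Qed.

(** Replacing row b of the Vandermonde matrix by the powers y_l^e either leaves
it unchanged or repeats a row. *)
Lemma sum_cofactor (b : 'I_m) e : (e < m)%N ->
  \sum_l 'X_l ^+ e * cofactor vdm_mx b l = if e == b then vdm else 0.
Proof.
move=> em; have := congr1 (fun M : 'M_m => M (Ordinal em) b) (mul_mx_adj vdm_mx).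
rewrite mxE [in RHS]mxE -/vdm => E.
transitivity (vdm *+ (Ordinal em == b)).
  by rewrite -E; apply: eq_bigr => l _; rewrite !mxE.
by rewrite -val_eqE /=; case: eqP.
Qed.

(** [O] acts on the variable y_l only, by y_l^b |-> f(b) y_l^(b-r); the condition
on [c] says that [c] does not involve y_l. The exponent b - r is truncated, so
this is meaningful together with [f_small] below. *)
Definition lowers l (O : {mpoly rat[m]} -> {mpoly rat[m]}) (f : nat -> rat) r :=
  forall b c, c^`M(l) = 0 -> O ('X_l ^+ b * c) = f b *: ('X_l ^+ (b - r) * c).

Variables (O : 'I_m -> {linear {mpoly rat[m]} -> {mpoly rat[m]}}).
Variables (f : nat -> rat) (r : nat).
Hypothesis O_lowers : forall l, lowers l (O l) f r.
Hypothesis f_small : forall b, (b < r)%N -> f b = 0.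

Lemma lowers_vdm l : O l vdm = \sum_(b < m) f b *: ('X_l ^+ (b - r) * cofactor vdm_mx b l).
Proof.
rewrite (vdm_expand l) linear_sum /=; apply: eq_bigr => b _.
by rewrite O_lowers // free_cofactor.
Qed.

(** Lowering one exponent of an alternant whose exponents are 0, .., m - 1
repeats an exponent. *)
Lemma sum_lowers_vdm : (0 < r)%N -> \sum_l O l vdm = 0.
Proof.
move=> r0; under eq_bigr do rewrite lowers_vdm.
rewrite exchange_big big1 //= => b _; rewrite -scaler_sumr.
case: (ltnP b r) => br; first by rewrite f_small // scale0r.
rewrite sum_cofactor; last by have := ltn_ord b; lia.
by case: eqP => [|_]; rewrite ?scaler0 //; lia.
Qed.

(** In p_p D the factor y_i^p either meets the operator in the same variable
(first term) or in another one. In the second case the sum over all pairs of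
variables vanishes by [sum_lowers_vdm], and what remains is minus the diagonal
(second term). *)
Lemma sum_lowers_powsum_vdm p : (0 < r)%N -> \sum_l O l (powsum p * vdm) =
  \sum_(b < m) \sum_l (f (b + p)%N *: ('X_l ^+ (b + p - r) * cofactor vdm_mx b l)
    - f b *: ('X_l ^+ (b - r + p) * cofactor vdm_mx b l)).
Proof.
move=> r0; rewrite exchange_big /=.
transitivity (\sum_l (O l ('X_l ^+ p * vdm) - 'X_l ^+ p * O l vdm +
    powsum p * O l vdm)).
  apply: eq_bigr => l _.
  rewrite [powsum p](bigD1 l) //= !mulrDl linearD /= addrA subrK; congr (_ + _).
  rewrite !mulr_suml linear_sum; apply: eq_bigr => i il /=.
  rewrite (lowers_vdm l) (vdm_expand l) !mulr_sumr linear_sum; apply: eq_bigr => b _ /=.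
  rewrite mulrCA O_lowers.
    by rewrite -scalerAr mulrCA.
  by rewrite mderivM free_cofactor mulr0 addr0 mderivX_exp (negPf il) mul0r.
rewrite big_split /= -mulr_sumr sum_lowers_vdm // mulr0 addr0; apply: eq_bigr => l _.
rewrite (lowers_vdm l) (vdm_expand l) !mulr_sumr linear_sum -sumrB /=.
apply: eq_bigr => b _; rewrite mulrA -exprD addnC O_lowers ?free_cofactor //.
by rewrite -scalerAr; congr (_ - _ *: _); rewrite mulrA -exprD [(p + _)%N]addnC.
Qed.

(** In [sum_lowers_powsum_vdm] both exponents are less than b as soon as the
weight in front is nonzero, so the cofactor sums vanish. *)
Lemma sum_lowers_powsum_vdm0 p : (p < r)%N -> \sum_l O l (powsum p * vdm) = 0.
Proof.
move=> pr; rewrite sum_lowers_powsum_vdm ?(leq_ltn_trans _ pr) // big1 // => b _.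
have bm := ltn_ord b.
rewrite sumrB -!scaler_sumr [X in _ - X](_ : _ = 0) ?subr0.
  case: (ltnP (b + p) r) => h; first by rewrite f_small // scale0r.
  by rewrite sum_cofactor; [case: eqP => [|_]; rewrite ?scaler0 //; lia | lia].
case: (ltnP b r) => h; first by rewrite f_small // scale0r.
by rewrite sum_cofactor; [case: eqP => [|_]; rewrite ?scaler0 //; lia | lia].
Qed.

(** Each term of [sum_lowers_powsum_vdm] returns to the exponent b, and the
weights telescope: only the p exponents just above the filled range
0, .., m - 1 survive. *)
Lemma sum_lowers_powsum_vdm_eq : (0 < r)%N ->
  \sum_l O l (powsum r * vdm) = (\sum_(i < r) f (m + i)%N) *: vdm.
Proof.
move=> r0; rewrite sum_lowers_powsum_vdm //.
transitivity (\sum_(b < m) (f (b + r)%N - f b) *: vdm).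
  apply: eq_bigr => b _; have bm := ltn_ord b.
  rewrite sumrB -!scaler_sumr addnK sum_cofactor // eqxx scalerBl.
  congr (_ - _); case: (ltnP b r) => h; first by rewrite f_small // !scale0r.
  by rewrite subnK // sum_cofactor // eqxx.
rewrite -scaler_suml; congr (_ *: _).
have E : \sum_(b < m + r) f b = \sum_(i < r) f i + \sum_(b < m) f (b + r)%N.
  rewrite addnC big_split_ord /=; congr (_ + _).
  by apply: eq_bigr => i _; rewrite addnC.
have F : \sum_(i < r) f i = 0 by apply: big1 => i _; apply: f_small.
by rewrite sumrB -[X in X - _]add0r -[X in X + _ - _]F -E big_split_ord /= addrAC subrr add0r.
Qed.

End Wedge.

(** * The Vandermonde determinant and the Laplacian *)

Section Vandermonde.
Variable m : nat.
Local Notation pw := (powsum m).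
Local Notation Delta := (vdm m).
Local Notation lapY := (lap (@id 'I_m)).
Local Notation gamY := (grad_form (@id 'I_m)).

Lemma vdm_neq0 : Delta != 0.
Proof.
rewrite /vdm /vdm_mx det_Vandermonde; apply/prodf_neq0 => i _; apply/prodf_neq0 => j ij.
rewrite !mxE; apply/eqP => /(congr1 (mderiv j)).
rewrite mderivB !mderivU eqxx raddf0 (_ : (i == j) = false).
  by rewrite subr0 => /eqP; rewrite oner_eq0.
by apply/negbTE; move: ij; rewrite ltn_neqAle => /andP[].
Qed.

Lemma mderiv_powsum i k : (pw k)^`M(i) = 'X_i ^+ k.-1 *+ k.
Proof.
rewrite /pw raddf_sum (bigD1 i) //= big1 ?addr0 => [|j ji].
  by rewrite mderivX_exp eqxx mul1n.
by rewrite mderivX_exp (negPf ji) mul0n mulr0n.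
Qed.

Lemma grad_form_powsum k l : gamY (pw k.+1) (pw l.+1) = pw (k + l) *+ (k.+1 * l.+1).
Proof.
rewrite /grad_form [pw (k + l)]/powsum -sumrMnl; apply: eq_bigr => i _.
by rewrite !mderiv_powsum /= exprD mulrnAr mulrnAl -mulrnA.
Qed.

Lemma lap_powsum k : lapY (pw k.+1) = pw k.-1 *+ k *+ k.+1.
Proof.
rewrite /lap [pw k.-1]/powsum -!sumrMnl; apply: eq_bigr => i _.
by rewrite mderiv_powsum /= raddfMn /= mderivX_exp eqxx mul1n.
Qed.

(** The Vandermonde determinant is harmonic: second derivatives lower an exponent
by two. *)
Lemma lap_vdm : lapY Delta = 0.
Proof.
pose O (l : 'I_m) : {linear {mpoly rat[m]} -> {mpoly rat[m]}} :=
  mderivm (U_(l) *+ 2).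
rewrite -(@sum_lowers_vdm _ O (fun b => (b ^_ 2)%:R) 2) //.
- by apply: eq_bigr => l _; rewrite /O /= !mderivnS mderivn0.
- by move=> l b c; apply: mderivn_freeM.
by move=> b b2; rewrite ffact_small.
Qed.

Lemma log_derivation (V : comNzRingType) (D : V -> V) (I : Type) (r : seq I)
    (P : pred I) (F q : I -> V) :
  D 1 = 0 -> (forall x y, D (x * y) = D x * y + x * D y) ->
  (forall i, P i -> D (F i) = F i * q i) ->
  D (\prod_(i <- r | P i) F i) = (\prod_(i <- r | P i) F i) * \sum_(i <- r | P i) q i.
Proof.
move=> D1 DM DF; elim/big_rec2: _ => [|i y z Pi IH]; first by rewrite D1 mulr0.
by rewrite DM DF // IH; ring.
Qed.

(** The derivation sum_i y_i^k d/dy_i multiplies each factor y_j - y_i by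
(y_j^k - y_i^k) / (y_j - y_i), hence multiplies D by the sum of these quotients
over pairs i < j. Doubling symmetrizes that sum, and the diagonal has to be
subtracted to get a polynomial in power sums. *)
Lemma euler_vdm k : (\sum_i 'X_i ^+ k * Delta^`M(i)) *+ 2 =
  Delta * (\sum_(b < k) pw b * pw (k.-1 - b) - pw k.-1 *+ k).
Proof.
pose D (f : {mpoly rat[m]}) := \sum_i 'X_i ^+ k * f^`M(i).
have D1 : D 1 = 0.
  by apply: big1 => i _; rewrite -[1]/(1%:MP) mderivC mulr0.
have DM f g : D (f * g) = D f * g + f * D g.
  rewrite /D mulr_suml mulr_sumr -big_split /=; apply: eq_bigr => i _.
  by rewrite mderivM; ring.
have DX i : D 'X_i = 'X_i ^+ k.
  rewrite /D (bigD1 i) //= big1 ?addr0 => [|j ji].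
    by rewrite mderivU eqxx mulr1.
  by rewrite mderivU eq_sym (negPf ji) mulr0.
have DB f g : D (f - g) = D f - D g.
  by rewrite /D -sumrB; apply: eq_bigr => i _; rewrite raddfB mulrBr.
(* The complete homogeneous quotient (y_i^k - y_j^k) / (y_i - y_j). *)
pose Q (i j : 'I_m) : {mpoly rat[m]} := \sum_(b < k) 'X_i ^+ (k.-1 - b) * 'X_j ^+ b.
have Qsym i j : Q i j = Q j i.
  rewrite /Q (reindex_inj rev_ord_inj) /=; apply: eq_bigr => b _.
  by rewrite mulrC; congr ('X_j ^+ _ * 'X_i ^+ _); have := ltn_ord b; lia.
have DDl : D Delta = Delta * \sum_(i < m) \sum_(j < m | (i < j)%N) Q j i.
  rewrite /vdm /vdm_mx det_Vandermonde.
  apply: log_derivation => // i _; apply: log_derivation => // j ij.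
  by rewrite !mxE DB !DX subrXX.
rewrite -/(D Delta) DDl -mulrnAr; congr (_ * _).
have QQ : \sum_(b < k) pw b * pw (k.-1 - b) = \sum_i \sum_j Q j i.
  under eq_bigr => b _ do rewrite /powsum mulr_suml.
  rewrite exchange_big /=; apply: eq_bigr => i _.
  under eq_bigr => b _ do rewrite mulr_sumr.
  rewrite exchange_big /=; apply: eq_bigr => j _.
  by apply: eq_bigr => b _; rewrite mulrC.
have Qd : pw k.-1 *+ k = \sum_i Q i i.
  rewrite /powsum -sumrMnl; apply: eq_bigr => i _.
  rewrite /Q -[X in _ *+ X](card_ord k) -sumr_const; apply: eq_bigr => b _.
  by rewrite -exprD subnK //; have := ltn_ord b; lia.
rewrite QQ Qd -sumrB mulr2n.
have -> : \sum_i (\sum_j Q j i - Q i i) =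
    \sum_(i < m) (\sum_(j < m | (i < j)%N) Q j i + \sum_(j < m | (j < i)%N) Q j i).
  apply: eq_bigr => i _; rewrite (bigD1 i) //= addrAC subrr add0r.
  rewrite (bigID (fun j : 'I_m => (i < j)%N)) /=.
  by congr (_ + _); apply: eq_bigl => j; rewrite -(inj_eq val_inj) /=; lia.
rewrite big_split /=; congr (_ + _).
rewrite [RHS](exchange_big_dep predT) //=; apply: eq_bigr => i _.
by apply: eq_bigr => j _; exact: Qsym.
Qed.

(** The same cutting of one power sum into two as for traces in [lap_tr_pow]: this
is why multiplication by D converts one Laplacian into the other. *)
Lemma lap_powsum_vdm k :
  lapY (pw k.+1 * Delta) = Delta * (\sum_(b < k) pw b * pw (k.-1 - b)) *+ k.+1.
Proof.
rewrite lapM // lap_vdm mulr0 add0r lap_powsum.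
have -> : gamY (pw k.+1) Delta = (\sum_i 'X_i ^+ k * Delta^`M(i)) *+ k.+1.
  by rewrite /grad_form -sumrMnl; apply: eq_bigr => i _; rewrite mderiv_powsum mulrnAl.
rewrite mulr_natl [_ *+ k.+1 *+ 2]mulrnAC euler_vdm.
by rewrite mulrnAl -mulrnDl mulrBr addrC [_ * Delta]mulrC subrK.
Qed.

Lemma mpolyX_exp i k : 'X_i ^+ k = 'X_[U_(i) *+ k] :> {mpoly rat[m]}.
Proof. by rewrite mpolyXn. Qed.

Lemma dual_to_powsum k : dual_to (@id 'I_m) k (pw k) (pw k).
Proof.
apply: dual_to_sum => i _; elim: k => [|k IH]; first exact: dual_to1.
by rewrite exprS; apply: (@dual_toX _ (@id 'I_m)).
Qed.

Lemma dop_powsum f k : dop f (pw k) = \sum_i f^`M(i, k).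
Proof.
rewrite linear_sum; apply: eq_bigr => i _ /=.
by rewrite mpolyX_exp dopXm.
Qed.

End Vandermonde.

(** * Radial parts of invariant differential operators *)

Section Radial.
Variable m' : nat.
Local Notation m := m'.+1.
Local Notation N := #|{: 'I_m * 'I_m}|.
Local Notation lapX := (lap (@entry_tr m')).
Local Notation gamX := (grad_form (@entry_tr m')).
Local Notation pw := (powsum m).
Local Notation Delta := (vdm m).
Local Notation lapY := (lap (@id 'I_m)).
Local Notation gamY := (grad_form (@id 'I_m)).
Local Notation t := (tr_pow m').

Definition diag_subst : N.-tuple {mpoly rat[m]} :=
  [tuple 'X_((enum_val k).1) *+ ((enum_val k).1 == (enum_val k).2) | k < N].
Local Notation rho := (comp_mpoly diag_subst).

Lemma rhoM f g : rho (f * g) = rho f * rho g.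
Proof. exact: rmorphM. Qed.

Lemma rho_tr_pow k : rho (t k) = pw k.
Proof.
have E : map_mx rho (gen_mx m' ^+ k) = diag_mx (\row_i 'X_i ^+ k).
  elim: k => [|k IH].
    rewrite expr0 map_mx1 -diag_const_mx; congr diag_mx.
    by apply/rowP => i; rewrite !mxE expr0.
  rewrite exprS -mulmxE map_mxM IH.
  have -> : map_mx rho (gen_mx m') = diag_mx (\row_i 'X_i).
    apply/matrixP => i j; rewrite !mxE comp_mpolyXU -tnth_nth tnth_mktuple.
    by rewrite /entry enum_rankK.
  rewrite mulmx_diag; congr diag_mx; apply/rowP => i.
  by rewrite !mxE exprS.
rewrite /tr_pow -trace_map_mx E mxtrace_diag.
by apply: eq_bigr => i _; rewrite mxE.
Qed.

(** The algebra generated by the traces of powers. Its elements are given by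
generators because the Laplacian is computed by induction on the number of
trace factors. *)
Inductive trace_poly : {mpoly rat[N]} -> Prop :=
  | trace_poly1 : trace_poly 1
  | trace_poly_t k f : trace_poly f -> trace_poly (t k.+1 * f)
  | trace_polyD f g : trace_poly f -> trace_poly g -> trace_poly (f + g)
  | trace_polyZ c f : trace_poly f -> trace_poly (c *: f).

Lemma trace_poly0 : trace_poly 0.
Proof. by rewrite -(scale0r 1); apply/trace_polyZ/trace_poly1. Qed.

Lemma trace_polyMn f k : trace_poly f -> trace_poly (f *+ k).
Proof. by rewrite -scaler_nat; apply: trace_polyZ. Qed.

Lemma trace_polyB f g : trace_poly f -> trace_poly g -> trace_poly (f - g).
Proof. by move=> fi gi; rewrite -[- g]scaleN1r; apply/trace_polyD/trace_polyZ. Qed.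

Lemma trace_poly_tr_powM k f : trace_poly f -> trace_poly (t k * f).
Proof.
case: k => [|k] fi; last exact: trace_poly_t.
by rewrite tr_pow0 mulr_natl; apply: trace_polyMn.
Qed.

Lemma trace_polyM f g : trace_poly f -> trace_poly g -> trace_poly (f * g).
Proof.
move=> fi gi; elim: fi => [|k {}f _ IH|f1 f2 _ IH1 _ IH2|c {}f _ IH].
- by rewrite mul1r.
- by rewrite -mulrA; apply: trace_poly_t.
- by rewrite mulrDl; apply: trace_polyD.
- by rewrite -scalerAl; apply: trace_polyZ.
Qed.

Lemma trace_poly_tr_pow k : trace_poly (t k).
Proof. by rewrite -[t k]mulr1; apply/trace_poly_tr_powM/trace_poly1. Qed.

Lemma trace_poly_sum (I : Type) (r : seq I) (P : pred I) F :
  (forall i, P i -> trace_poly (F i)) -> trace_poly (\sum_(i <- r | P i) F i).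
Proof.
by move=> Fi; elim/big_ind: _ => // *; [exact: trace_poly0 | exact: trace_polyD].
Qed.

Lemma trace_poly_lap k : trace_poly (lapX (t k.+1)).
Proof.
by rewrite lap_tr_pow; apply/trace_polyMn/trace_poly_sum => b _; apply: trace_polyM; apply: trace_poly_tr_pow.
Qed.

(** Radial part of the Laplacian. The last clause is carried along because the
carre du champ with a trace is the cross term created by one more factor. *)
Lemma radial_lap f : trace_poly f ->
  [/\ trace_poly (lapX f), Delta * rho (lapX f) = lapY (Delta * rho f) &
   forall k, trace_poly (gamX (t k.+1) f) /\
             rho (gamX (t k.+1) f) = gamY (pw k.+1) (rho f)].
Proof.
have d1 n i : (1 : {mpoly rat[n]})^`M(i) = 0 by rewrite -[1]/(1%:MP) mderivC.
elim=> [|l {}f fi [IH1 IH2 IH3]|g1 g2 _ [I1 I2 I3] _ [J1 J2 J3]|c g _ [I1 I2 I3]].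
- have gam1 n tau g : @grad_form n tau g 1 = 0.
    by apply: big1 => i _; rewrite d1 mulr0.
  have -> : lapX 1 = 0 by apply: big1 => i _; rewrite d1 raddf0.
  split; first exact: trace_poly0.
    by rewrite rmorph1 mulr1 lap_vdm raddf0 mulr0.
  by move=> k; rewrite gam1 rmorph1 gam1 raddf0; split; first exact: trace_poly0.
- split.
  + rewrite lapM; last exact: entry_trK.
    rewrite mulr_natl; apply: trace_polyD; first apply: trace_polyD.
    * exact: trace_poly_t.
    * by apply: trace_polyM => //; exact: trace_poly_lap.
    * by apply/trace_polyMn/(IH3 l).1.
  + rewrite lapM; last exact: entry_trK.
    rewrite !rmorphD /= !rhoM rmorph_nat rho_tr_pow (IH3 l).2.
    (* The case of a single trace, where the two Laplacians cut alike. *)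
have key : Delta * rho (lapX (t l.+1)) = lapY (pw l.+1 * Delta).
      rewrite lap_powsum_vdm lap_tr_pow raddfMn raddf_sum -mulrnAr; congr (_ * (_ *+ _)).
      by apply: eq_bigr => b _ /=; rewrite rhoM !rho_tr_pow.
    rewrite lapM // lap_vdm mulr0 add0r in key.
    rewrite [RHS](_ : _ = lapY (pw l.+1 * (Delta * rho f))); last by congr lap; ring.
    rewrite lapM // -IH2 grad_formM.
    move: key; move: (rho (lapX f)) (rho (lapX (t l.+1))) (gamY _ (rho f)).
    move: (rho f) (gamY _ Delta) (lapY (pw l.+1)) => a b c e g h key.
    transitivity (pw l.+1 * (Delta * e) + (Delta * g) * a + 2%:R * (Delta * h)); first by ring.
    by rewrite key; ring.
  + move=> k; rewrite grad_formM rhoM rho_tr_pow grad_formM !rmorphD /= !rhoM grad_form_tr_pow grad_form_powsum.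
    rewrite rho_tr_pow (IH3 k).2 raddfMn /= rho_tr_pow; split=> //.
    by apply: trace_polyD; [apply/trace_poly_t/(IH3 k).1 | apply/trace_polyM/fi/trace_polyMn/trace_poly_tr_pow].
- rewrite !linearD; split; first exact: trace_polyD.
    by rewrite !mulrDr /= I2 J2 linearD.
  move=> k; rewrite !linearD /= (I3 k).2 (J3 k).2; split => //.
  by apply: trace_polyD; [exact: (I3 k).1 | exact: (J3 k).1].
- rewrite !linearZ; split; first exact: trace_polyZ.
    by rewrite -!scalerAr /= I2 linearZ.
  move=> k; rewrite !linearZ /= (I3 k).2; split => //.
  by apply/trace_polyZ/(I3 k).1.
Qed.

(** The operator [B] is the radial part of [A], conjugated by D. *)
Definition intertwines (A : {mpoly rat[N]} -> {mpoly rat[N]})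
    (B : {mpoly rat[m]} -> {mpoly rat[m]}) :=
  forall f, trace_poly f -> trace_poly (A f) /\ Delta * rho (A f) = B (Delta * rho f).

Lemma intertwines_ad j A B : intertwines A B ->
  intertwines (iter j (ad lapX) A) (iter j (ad lapY) B).
Proof.
move=> AB; elim: j => [|j IH] //= f fi.
have [f1 f2 _] := radial_lap fi.
have [g1 g2] := IH f fi; have [h1 h2 _] := radial_lap g1.
have [k1 k2] := IH _ f1.
rewrite !adE; split; first exact: trace_polyB.
by rewrite rmorphB mulrBr /= h2 g2 k2 f2.
Qed.

Lemma intertwines_tr_pow k : intertwines ( *%R (t k)) ( *%R (pw k)).
Proof.
by move=> f fi; split; [exact: trace_poly_tr_powM | rewrite rhoM rho_tr_pow mulrCA].
Qed.

(** Commutators of intertwined operators are intertwined, and the k-fold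
commutators of the Laplacians with t_k and p_k are tr (d/dX)^k and
sum_i (d/dy_i)^k, with the same scalar. *)
Lemma radial_dop k f : trace_poly f -> trace_poly (dop f (t k)) /\
  Delta * rho (dop f (t k)) = \sum_i (Delta * rho f)^`M(i, k).
Proof.
move=> fi; have [] := intertwines_ad k (intertwines_tr_pow k) fi.
rewrite (dual_to_tr_pow k f).1 (dual_to_powsum k (Delta * rho f)).1 dop_powsum => i1 E.
have c0 : (2 ^ k * k`!)%:R != 0 :> rat.
  by rewrite pnatr_eq0 muln_eq0 expn_eq0 /= -lt0n fact_gt0.
split.
  have := trace_polyZ (2 ^ k * k`!)%:R^-1 i1.
  by rewrite -scaler_nat scalerA mulVf // scale1r.
apply: (scalerI c0); rewrite !scaler_nat -E -mulrnAr; congr (_ * _).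
by rewrite raddfMn.
Qed.

End Radial.

(** * Closed walks along the cycles of a permutation *)

Section CycleTraces.
Variables (R : comNzRingType) (m' : nat) (A : 'M[R]_m'.+1).
Variable (T : finType).
Local Notation m := m'.+1.
Implicit Types (h : {ffun T -> 'I_m}) (x : T) (l : seq T).

Definition upd h x a : {ffun T -> 'I_m} := [ffun y => if y == x then a else h y].
(** Functions on a part of [T] are encoded as functions on [T] that take the
default value [ord0] elsewhere, so that sums over parts can be compared. *)
Definition supported_in (D : mem_pred T) h := [forall y, in_mem y D || (h y == ord0)].
Local Notation supported D := (supported_in (mem D)).

Lemma supportedP (D : mem_pred T) h : reflect (forall y, ~~ in_mem y D -> h y = ord0) (supported_in D h).
Proof.
apply: (iffP forallP) => H y; first by move=> /negPf yl; have := H y; rewrite yl => /eqP.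
by case: (boolP (in_mem y D)) => //= /H ->.
Qed.

Lemma sum_supported_cons x l (Phi : {ffun T -> 'I_m} -> R) : x \notin l ->
  \sum_(h | supported (x :: l) h) Phi h = \sum_a \sum_(h | supported l h) Phi (upd h x a).
Proof.
move=> xl; rewrite (partition_big (fun h : {ffun T -> 'I_m} => h x) predT) //=.
apply: eq_bigr => a _.
rewrite (reindex_onto (fun h => upd h x a) (fun h => upd h x ord0)) /=.
  apply: eq_bigl => h; apply/andP/idP => [[/andP[/supportedP H1 _] /eqP H2]|/supportedP H].
    apply/supportedP => y yl; rewrite -H2 !ffunE; case: eqP => // /eqP yx.
    by have := H1 y; rewrite !ffunE inE (negPf yx) (negPf yl) => ->.
  split; first (apply/andP; split; last by rewrite ffunE eqxx).
    apply/supportedP => y; rewrite inE ffunE; case: eqP => //= _; exact: H.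
  apply/eqP/ffunP => y; rewrite !ffunE; case: eqP => // ->.
  by rewrite H.
move=> h /andP[_ /eqP hx]; apply/ffunP => y; rewrite !ffunE.
by case: eqP => // ->.
Qed.

(** The weight of the walk from [i] to [j] through the values of [h] along [l];
summing over [h] yields an entry of a matrix power. *)
Fixpoint walk (i : 'I_m) l h (j : 'I_m) : R :=
  if l is x :: l' then A i (h x) * walk (h x) l' h j else A i j.

Lemma walk_upd i l h j x a : x \notin l -> walk i l (upd h x a) j = walk i l h j.
Proof.
elim: l i => //= y l IH i; rewrite inE negb_or => /andP[xy xl].
by rewrite !ffunE eq_sym (negPf xy) IH.
Qed.

Lemma walk_sum l i j : uniq l ->
  \sum_(h | supported l h) walk i l h j = (A ^+ (size l).+1) i j.
Proof.
elim: l i => [|x l IH] i /=.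
  move=> _; rewrite (big_pred1 [ffun=> ord0]) ?expr1 // => h /=.
  apply/supportedP/eqP => [H|->]; last by move=> y; rewrite ffunE.
  by apply/ffunP => y; rewrite ffunE H.
move=> /andP[xl ul]; rewrite sum_supported_cons // exprS mxE; apply: eq_bigr => a _.
under eq_bigr do rewrite ffunE eqxx walk_upd //.
by rewrite -mulr_sumr IH.
Qed.

Variable s : {perm T}.

Lemma prod_fpath_walk h x l : fpath s x l ->
  \prod_(i <- x :: l) A (h i) (h (s i)) = walk (h x) l h (h (s (last x l))).
Proof.
elim: l x => [|y l IH] x /=; first by rewrite big_seq1.
by move=> /andP[/eqP sx yl]; rewrite big_cons IH //= sx.
Qed.

Lemma sum_porbit x :
  \sum_(h | supported (porbit s x) h) \prod_(i in porbit s x) A (h i) (h (s i)) =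
  \tr (A ^+ #|porbit s x|).
Proof.
set k := #|_|; have k0 : (0 < k)%N by rewrite lt0n card_porbit_neq0.
have /= := uniq_traject_porbit s x; rewrite -/k.
have lE : traject s x k = x :: traject s (s x) k.-1 by rewrite -{1}(prednK k0).
have memC : porbit s x =i x :: traject s (s x) k.-1.
  by move=> y; rewrite porbit_traject -/k lE.
rewrite lE; set l := traject s (s x) k.-1 in lE memC * => ul.
have W h : \prod_(i in porbit s x) A (h i) (h (s i)) = walk (h x) l h (h x).
  transitivity (\prod_(i <- x :: l) A (h i) (h (s i))).
    by rewrite big_uniq //; apply: eq_bigl => y; rewrite memC.
  rewrite prod_fpath_walk ?fpath_traject // last_traject -iterS prednK //.
  by rewrite /k iter_porbit.
under eq_bigr do rewrite W.
have /andP[xl ul'] := ul.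
transitivity (\sum_(h | supported (x :: l) h) walk (h x) l h (h x)).
  by apply: eq_bigl => h; apply: eq_forallb => y; rewrite memC.
rewrite sum_supported_cons // /mxtrace; apply: eq_bigr => a _.
under eq_bigr do rewrite ffunE eqxx walk_upd //.
by rewrite walk_sum // size_traject prednK.
Qed.

(** The summand factors over the cycles of [s], and a function on [T] amounts to
a family of functions on the cycles. *)
Lemma sum_prod_cycles :
  \sum_(f : {ffun T -> 'I_m}) \prod_i A (f i) (f (s i)) =
  \prod_(C in porbits s) \tr (A ^+ #|pred_of_set C|).
Proof.
pose P := porbits s; pose h0 : {ffun T -> 'I_m} := [ffun=> ord0].
have PP C x : C \in P -> (porbit s x == C) = (x \in C).
  by move=> /imsetP[y _ ->]; rewrite eq_porbit_mem.
pose W C h := \prod_(i in pred_of_set C) A (h i) (h (s i)).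
transitivity (\prod_(C in P) \sum_(h | supported C h) W C h); last first.
  by apply: eq_bigr => C /imsetP[x _ ->]; exact: sum_porbit.
rewrite (big_distr_big_dep h0) /=.
(* The family of restrictions of h to the cycles, and the gluing map. *)
pose cut h C : {ffun T -> 'I_m} := [ffun x => if x \in pred_of_set C then h x else ord0].
pose F h : {ffun {set T} -> {ffun T -> 'I_m}} :=
  [ffun C => if C \in P then cut h C else h0].
pose G (H : {ffun {set T} -> {ffun T -> 'I_m}}) : {ffun T -> 'I_m} :=
  [ffun x => H (porbit s x) x].
have inP x : porbit s x \in P by apply: imset_f.
rewrite (reindex_onto F G) /=; last first.
  move=> H /pfamilyP [/supportP H1 H2]; apply/ffunP => C; rewrite ffunE.
  case: (boolP (C \in P)) => CP; last by rewrite H1.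
  apply/ffunP => x; rewrite !ffunE; case: ifP => xC.
    by congr (H _ x); apply/eqP; rewrite PP.
  by have /supportedP -> := H2 C CP; rewrite ?xC.
apply: eq_big => [h|h _].
  symmetry; apply/andP; split.
    apply/pfamilyP; split=> [|C CP].
      by apply/supportP => C CP; rewrite ffunE (negPf CP).
    by apply/supportedP => x xC; rewrite ffunE CP ffunE (negPf xC).
  by apply/eqP/ffunP => x; rewrite !ffunE inP ffunE porbit_id.
rewrite (partition_big (porbit s) (mem P)) //=; apply: eq_bigr => C CP.
rewrite /W (eq_bigl _ _ (PP C ^~ CP)).
have [y _ Cy] := imsetP CP.
apply: eq_bigr => i iC; rewrite !ffunE CP !ffunE iC.
have -> // : s i \in C.
have E : porbit s (s i) = porbit s i by have := porbit_perm s 1 i; rewrite expg1.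
by rewrite Cy -eq_porbit_mem E eq_porbit_mem -Cy.
Qed.

End CycleTraces.

(** * The pairing of products of traces *)

Section Wick.
Variable N : nat.

Lemma dop_suml (I : Type) (r : seq I) (P : pred I) (F : I -> {mpoly rat[N]}) q :
  dop (\sum_(i <- r | P i) F i) q = \sum_(i <- r | P i) dop (F i) q.
Proof.
rewrite /dop exchange_big /=; apply: eq_bigr => k _.
by rewrite linear_sum scaler_sumr.
Qed.

Lemma mderiv_prod n (F : 'I_n.+1 -> {mpoly rat[N]}) c :
  (\prod_i F i)^`M(c) = \sum_i (F i)^`M(c) * \prod_(j < n) F (lift i j).
Proof.
elim: n F => [|n IH] F; first by rewrite !big_ord1 big_ord0 mulr1.
rewrite big_ord_recl mderivM [RHS]big_ord_recl; congr (_ + _).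
rewrite IH mulr_sumr; apply: eq_bigr => i _.
rewrite mulrCA [in RHS]big_ord_recl; congr (_ * (F _ * _)).
  by apply: val_inj.
apply: eq_bigr => j _; congr (F _); apply: val_inj; rewrite /= /bump /=; lia.
Qed.

(** A permutation is determined by the image of 0 and by a permutation of the
remaining points. *)
Lemma sum_lift_perm n (V : nmodType) (G : 'S_n.+1 -> V) :
  \sum_s G s = \sum_j \sum_s G (lift_perm ord0 j s).
Proof.
pose u (js : 'I_n.+1 * 'S_n) := lift_perm ord0 js.1 js.2.
have u_inj : injective u.
  move=> [j s] [j' s'] E.
  have jj : j = j' by have := congr1 (fun v : 'S_n.+1 => v ord0) E; rewrite /u !lift_perm_id.
  rewrite -jj in E *; congr (_, _); apply/permP => k.
  have := congr1 (fun v : 'S_n.+1 => v (lift ord0 k)) E.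
  by rewrite /u !lift_perm_lift; apply: lift_inj.
have u_bij : bijective u.
  apply: inj_card_bij => //; rewrite card_prod card_ord !card_Sn.
  by rewrite -factS.
by rewrite pair_big /= (reindex u) //; exact: onW_bij.
Qed.

(** Wick's rule: the first derivative hits some factor [j], which is the value of
[s] at 0, and the others are paired by induction. *)
Lemma dop_prod_var n (h e : 'I_n -> 'I_N) :
  dop (\prod_j 'X_(h j)) (\prod_i 'X_(e i)) =
  \sum_(s : 'S_n) \prod_i ((h (s i) == e i)%:R : {mpoly rat[N]}).
Proof.
elim: n h e => [|n IH] h e.
  rewrite !big_ord0 dop1 (eq_bigr (fun=> 1)); last by move=> s _; rewrite big_ord0.
  by rewrite sumr_const -cardsT -[RHS]/(_%:R); have := card_Sn 0; rewrite cardsT => ->.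
rewrite [\prod_i 'X_(e i)]big_ord_recl dopM dopX mderiv_prod dop_suml sum_lift_perm.
apply: eq_bigr => j _; rewrite mderivU.
have -> b (f q : {mpoly rat[N]}) : dop (b%:R * f) q = b%:R * dop f q.
  by rewrite !mulr_natl -(card_ord b) -!sumr_const dop_suml.
rewrite IH mulr_sumr; apply: eq_bigr => s _.
rewrite [RHS]big_ord_recl lift_perm_id; congr (_ * _).
by apply: eq_bigr => i _; rewrite lift_perm_lift.
Qed.

End Wick.

Section WickTraces.
Variables (m' n : nat).
Local Notation m := m'.+1.
Local Notation t := (tr_pow m').
Implicit Types a g : 'S_n.

Definition trace_prod (a : 'S_n) := \prod_(C in porbits a) t #|pred_of_set C|.

(** Write both products as sums over colourings of the n points. A pairing [s]
of the factors forces the colouring of one product to be the pullback of the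
colouring of the other; the remaining colouring must be constant on the cycles
of a^-1 ^ s * g, and the number of such colourings is given by
[sum_prod_cycles] at the identity matrix. *)
Lemma dop_trace_prod a g :
  dop (trace_prod g) (trace_prod a) = \sum_(s : 'S_n) m%:R ^+ kappa (a^-1 ^ s * g)%g.
Proof.
have PE b : trace_prod b = \sum_(f : {ffun 'I_n -> 'I_m}) \prod_i 'X_(entry (f i) (f (b i))).
  rewrite /trace_prod -(sum_prod_cycles (gen_mx m') b); apply: eq_bigr => f _.
  by apply: eq_bigr => i _; rewrite mxE.
rewrite !PE dop_suml.
under eq_bigr => h _.
  rewrite linear_sum /=.
  under eq_bigr do rewrite dop_prod_var.
  rewrite exchange_big /=.
  over.
rewrite exchange_big /=; apply: eq_bigr => s _.
have -> : m%:R ^+ kappa (a^-1 ^ s * g)%g =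
    \prod_(C in porbits (a^-1 ^ s * g)%g) \tr ((1%:M : 'M[{mpoly rat[#|{: 'I_m * 'I_m}|]}]_m) ^+ #|pred_of_set C|).
  rewrite (eq_bigr (fun=> m%:R)) ?prodr_const //.
  by move=> C _; rewrite expr1n mxtrace1.
rewrite -sum_prod_cycles; apply: eq_bigr => h _.
rewrite (bigD1 [ffun i => h (s i)]) //= [X in _ + X]big1 ?addr0.
  rewrite (reindex_inj (@perm_inj _ (s^-1 * a^-1)%g)) /=.
  apply: eq_bigr => k _; rewrite mxE entry_eq !ffunE !permM !permKV eqxx.
  by rewrite [in RHS]eq_sym.
move=> f fh; have [i fi] : exists i, h (s i) != f i.
  apply/existsP; apply: contraR fh; rewrite negb_exists => /forallP H.
  by apply/eqP/ffunP => i; rewrite ffunE; apply/esym/eqP; have := H i; rewrite negbK.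
by rewrite (bigD1 i) //= entry_eq (negPf fi) mul0r.
Qed.

End WickTraces.

(** * Evaluation for the cycle types [k^d] and [p, a] *)

(** Left and right composition with [L] commute, so the binomial formula applies
to their difference. *)
Lemma iter_ad_expand (V : lmodType rat) (L : {linear V -> V}) (A : V -> V) d g :
  iter d (ad L) A g =
  \sum_(j < d.+1) ((-1) ^+ (d - j) * 'C(d, j)%:R) *:
     iter j L (A (iter (d - j) L g)).
Proof.
elim: d g => [|d IH] g; first by rewrite big_ord1 /= expr0 mul1r scale1r.
rewrite iterS adE !IH linear_sum /=.
pose T j i := iter j L (A (iter i L g)).
pose c (d j : nat) : rat := (-1) ^+ (d - j) * 'C(d, j)%:R.
have -> : \sum_(i < d.+1) L (c d i *: T i (d - i)%N) =
          \sum_(i < d.+1) c d i *: T i.+1 (d - i)%N.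
  by apply: eq_bigr => j _; rewrite linearZ.
have -> : \sum_(i < d.+1) c d i *: iter i L (A (iter (d - i) L (L g))) =
          \sum_(i < d.+1) c d i *: T i (d.+1 - i)%N.
  by apply: eq_bigr => j _; rewrite /T -iterSr subSn // -ltnS.
rewrite [X in _ - X]big_ord_recl [RHS]big_ord_recl /= opprD addrA addrAC.
rewrite -sumrN.
have -> : (((-1) ^+ (d.+1 - 0) * 'C(d.+1, 0)%:R) *: T 0 d.+1 : V) =
     - (c d 0 *: T 0 d.+1).
  by rewrite -scaleNr /c !subn0 !bin0 exprS; congr (_ *: _); ring.
rewrite [RHS]addrC; congr (_ - _).
have -> : \sum_(i < d) - (c d (lift ord0 i) *: T (lift ord0 i) (d.+1 - lift ord0 i)%N) =
  \sum_(i < d.+1) ((-1) ^+ (d - i) * 'C(d, i.+1)%:R) *: T i.+1 (d - i)%N.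
  rewrite big_ord_recr /= bin_small // mulr0 scale0r addr0.
  apply: eq_bigr => i _; rewrite -scaleNr /c /= /bump /= add1n; congr (_ *: _).
  have -> : (d - i = (d - i.+1).+1)%N by have := ltn_ord i; lia.
  by rewrite exprS; ring.
rewrite -big_split /=; apply: eq_bigr => i _.
rewrite -scalerDl /c /bump /= add1n subSS binS natrD; congr (_ *: _); ring.
Qed.

Section Evaluation.
Variables (m d k a p : nat).
Hypotheses (apE : (a + p = d * k)%N) (p0 : (0 < p)%N) (pk : (p < k)%N).
Local Notation pw := (powsum m).
Local Notation Delta := (vdm m).
Implicit Types (l : 'I_m) (g : {mpoly rat[m]}).

(** The radial part of tr (d/dX)^k. *)
Definition dpow g : {mpoly rat[m]} := \sum_l g^`M(l, k).

Lemma dpow_is_linear : linear dpow.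
Proof.
move=> c f g; rewrite /dpow scaler_sumr -big_split /=; apply: eq_bigr => l _.
by rewrite linearP.
Qed.
HB.instance Definition _ := GRing.isLinear.Build rat {mpoly rat[m]}
  {mpoly rat[m]} _ dpow dpow_is_linear.

Definition ad_mul l : {mpoly rat[m]} -> {mpoly rat[m]} :=
  iter d (ad (mderivm (U_(l) *+ k))) ( *%R ('X_l ^+ a)).

Definition signed_bin (j : nat) : rat := (-1) ^+ (d - j) * 'C(d, j)%:R.

Lemma iter_mderivn l j g :
  iter j (mderivm (U_(l) *+ k)) g = g^`M(l, (j * k)%N).
Proof.
elim: j => [|j IH] /=; first by rewrite mderivn0.
rewrite IH -mderivmDm; congr (_^`M[_]).
by apply/mnmP => i; rewrite mnmDE !mulmnE; lia.
Qed.

Lemma ad_mulE l g : ad_mul l g =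
  \sum_(j < d.+1) signed_bin j *: ('X_l ^+ a * g^`M(l, ((d - j) * k)%N))^`M(l, (j * k)%N).
Proof.
rewrite /ad_mul iter_ad_expand; apply: eq_bigr => j _.
by rewrite !iter_mderivn.
Qed.

Lemma ad_mul_is_linear l : linear (ad_mul l).
Proof.
move=> c f g; rewrite !ad_mulE scaler_sumr -big_split /=; apply: eq_bigr => j _.
by rewrite linearP mulrDr -scalerAr linearP scalerDr !scalerA mulrC.
Qed.
HB.instance Definition _ l := GRing.isLinear.Build rat {mpoly rat[m]}
  {mpoly rat[m]} _ (ad_mul l) (ad_mul_is_linear l).

(** The factor by which the iterated commutator of (d/dy)^k with y^a multiplies
y^b, while lowering the exponent by p = dk - a. *)
Definition weight (b : nat) : rat :=
  \sum_(j < d.+1) signed_bin j *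
     (b ^_ ((d - j) * k) * (b - (d - j) * k + a) ^_ (j * k))%:R.

Lemma ad_mul_lowers l : lowers l (ad_mul l) weight p.
Proof.
move=> b c c0; rewrite ad_mulE /weight scaler_suml; apply: eq_bigr => j _.
rewrite (mderivn_freeM _ _ c0) -scalerAr mulrA -exprD linearZ /=.
rewrite (mderivn_freeM _ _ c0).
rewrite !scalerA natrM [(a + _)%N]addnC -!mulrA.
have jd : (j * k + (d - j) * k = d * k)%N.
  by rewrite -mulnDl subnKC // -ltnS.
case: (ltnP b ((d - j) * k)) => h1.
  by rewrite ffact_small // !mul0r !mulr0 !scale0r.
case: (ltnP (b - (d - j) * k + a) (j * k)) => h2.
  by rewrite (ffact_small h2) !mulr0 !scale0r.
by congr (_ *: ('X_l ^+ _ * _)); lia.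
Qed.

Lemma weight_small b : (b < p)%N -> weight b = 0.
Proof.
move=> bp; apply: big1 => j _.
have jd : (j * k + (d - j) * k = d * k)%N.
  by rewrite -mulnDl subnKC // -ltnS.
case: (ltnP b ((d - j) * k)) => h1.
  by rewrite ffact_small // mul0n mulr0.
by rewrite [X in (_ * X)%N]ffact_small ?muln0 ?mulr0 //; lia.
Qed.

(** This is where p < k is used: P lowers degrees by more than p_p raises them. *)
Lemma dpow_powsum_vdm : dpow (pw p * Delta) = 0.
Proof.
pose O l : {linear {mpoly rat[m]} -> {mpoly rat[m]}} := mderivm (U_(l) *+ k).
apply: (@sum_lowers_powsum_vdm0 _ O (fun b => (b ^_ k)%:R) k) => //.
- by move=> l b c; apply: mderivn_freeM.
by move=> b bk; rewrite ffact_small.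
Qed.

Lemma mderivn_XM l i e j g : i != l ->
  ('X_l ^+ e * g)^`M(i, j) = 'X_l ^+ e * g^`M(i, j).
Proof.
move=> il; elim: j => [|j IH]; first by rewrite !mderivn0.
rewrite mderivnS IH mderivM mderivX_exp eq_sym (negPf il) mul0n mulr0n mul0r.
by rewrite add0r -mderivnS.
Qed.

(** Since P kills [g], P can be replaced by its commutator with y_l^a, to which
only the summand (d/dy_l)^k of P contributes. *)
Lemma iter_dpow l g c : dpow g = 0 ->
  iter c dpow ('X_l ^+ a * g) =
  iter c (ad (mderivm (U_(l) *+ k))) ( *%R ('X_l ^+ a)) g.
Proof.
move=> g0; elim: c => [|c IH] //; rewrite iterS IH iterS adE.
set B := iter c _ _.
have BC i f : i != l -> (B f)^`M(i, k) = B f^`M(i, k).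
  move=> il; rewrite /B; elim: c f {IH B} => [|c IH] f /=.
    exact: mderivn_XM.
  have dC h : h^`M(l, k)^`M(i, k) = h^`M(i, k)^`M(l, k).
    by rewrite -!mderivmDm addmC.
  by rewrite /ad linearB /= dC !IH dC.
have BD : {morph B : f h / f + h}.
  rewrite /B; elim: c {IH B BC} => [|c IH] f h /=; first by rewrite mulrDr.
  by rewrite /ad linearD /= !IH linearD /= opprD addrACA.
have B0 : B 0 = 0 by apply: (addrI (B 0)); rewrite -BD !addr0.
rewrite {1}/dpow (bigD1 l) //=; congr (_ + _).
rewrite (eq_bigr _ (fun i il => BC i g il)) -(big_morph B BD B0).
apply/eqP; rewrite -addr_eq0 addrC -BD.
by move: g0; rewrite /dpow (bigD1 l) //= => ->; rewrite B0.
Qed.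

Lemma iter_dpow_eval :
  iter d dpow (pw a * (pw p * Delta)) = (\sum_(i < p) weight (m + i)%N) *: Delta.
Proof.
rewrite -(sum_lowers_powsum_vdm_eq ad_mul_lowers weight_small p0).
have DS c (F : 'I_m -> {mpoly rat[m]}) : iter c dpow (\sum_l F l) = \sum_l iter c dpow (F l).
  by elim: c => //= c ->; rewrite linear_sum.
rewrite [pw a]/powsum mulr_suml DS; apply: eq_bigr => l _.
by rewrite iter_dpow // dpow_powsum_vdm.
Qed.

(** For b >= dk all falling factorials are quotients of factorials, and the two
products are equal to b! (b-u+a)! / ((b-u)! (b-p)!) with u = (d-j)k. *)
Lemma weight_large b : (d * k <= b)%N ->
  weight b = \sum_(j < d.+1) signed_bin j * (b ^_ p * (b - p + j * k) ^_ a)%:R.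
Proof.
move=> nb; apply: eq_bigr => j _; congr (_ * _%:R).
have jd : (j * k + (d - j) * k = d * k)%N.
  by rewrite -mulnDl subnKC // -ltnS.
move: (j * k)%N ((d - j) * k)%N jd => w u wu.
have E1 : (b ^_ u * (b - u)`! = b`!)%N by apply: ffact_fact; lia.
have E2 : ((b - u + a) ^_ w * (b - p)`! = (b - u + a)`!)%N.
  by rewrite -[RHS](@ffact_fact _ w); [congr (_ * _`!)%N; lia | lia].
have E3 : (b ^_ p * (b - p)`! = b`!)%N by apply: ffact_fact; lia.
have E4 : ((b - p + w) ^_ a * (b - u)`! = (b - u + a)`!)%N.
  have -> : (b - u + a = b - p + w)%N by lia.
  by rewrite -[RHS](@ffact_fact _ a); [congr (_ * _`!)%N; lia | lia].
apply/eqP; rewrite -(eqn_pmul2r (fact_gt0 (b - p))) -(eqn_pmul2r (fact_gt0 (b - u))).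
apply/eqP.
transitivity ((b ^_ u * (b - u)`!) * ((b - u + a) ^_ w * (b - p)`!))%N; first by ring.
by rewrite E1 E2 -E3 -E4; ring.
Qed.

End Evaluation.

(** * Cycle types *)

Section CycleTypes.
Variable n : nat.
Implicit Types s t : 'S_n.

Lemma porbit_conj s t x : porbit (s ^ t)%g (t x) = t @: porbit s x.
Proof.
have E i : ((s ^ t) ^+ i)%g (t x) = t ((s ^+ i)%g x).
  by rewrite -conjXg conjgE !permM permK.
apply/setP => y; apply/porbitP/imsetP => [[i ->]|[z /porbitP[i ->] ->]].
  by exists ((s ^+ i)%g x); rewrite ?mem_porbit.
by exists i.
Qed.

Lemma cycle_lengths_conj s t : perm_eq (cycle_lengths (s ^ t)%g) (cycle_lengths s).
Proof.
have tI : injective (fun C : {set 'I_n} => t @: C) by apply/imset_inj/perm_inj.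
have -> : cycle_lengths s = [seq #|pred_of_set C| | C <- [seq t @: (C : {set 'I_n}) | C <- enum (porbits s)]].
  by rewrite -map_comp; apply: eq_map => C /=; rewrite card_imset //; exact: perm_inj.
apply/perm_map/uniq_perm; rewrite ?enum_uniq ?map_inj_uniq ?enum_uniq //.
move=> C; rewrite mem_enum; apply/imsetP/mapP => [[x _ ->]|[D]].
  exists (porbit s (t^-1%g x)); first by rewrite mem_enum imset_f.
  by rewrite -porbit_conj permKV.
by rewrite mem_enum => /imsetP[x _ ->] ->; exists (t x); rewrite // porbit_conj.
Qed.

Lemma cycle_class_conjV lambda s t :
  ((s^-1 ^ t)%g \in cycle_class n lambda) = (s \in cycle_class n lambda).
Proof.
rewrite !inE /has_cycle_type; have /permPl -> := cycle_lengths_conj s^-1%g t.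
by rewrite /cycle_lengths porbitsV.
Qed.

Lemma mem_cycle_lengths s x : #|porbit s x| \in cycle_lengths s.
Proof. by apply: map_f; rewrite mem_enum imset_f. Qed.

Lemma card_porbit_nseq s k d x : has_cycle_type s (nseq d k) -> #|porbit s x| = k.
Proof.
move=> /perm_mem/(_ #|porbit s x|); rewrite mem_cycle_lengths mem_nseq.
by case/esym/andP => _ /eqP.
Qed.

Lemma sum_card_porbits s : (\sum_(C in porbits s) #|pred_of_set C| = n)%N.
Proof.
rewrite -[RHS]card_ord -[RHS]sum1_card.
rewrite [RHS](partition_big (porbit s) (mem (porbits s))) /=; last by move=> x _; exact: imset_f.
apply: eq_bigr => _ /imsetP[y _ ->]; rewrite -sum1_card; apply: eq_bigl => x.
by rewrite eq_porbit_mem.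
Qed.

(** The cycle of [s] through a point of the p-cycle of [t] has length k > p, so
it leaves that p-cycle and reaches the only other cycle of [t]. *)
Lemma generates_transitive_nseq s t p q k d :
  (0 < p)%N -> (p < k)%N ->
  has_cycle_type s (nseq d k) -> has_cycle_type t [:: p; q] ->
  generates_transitive s t.
Proof.
move=> p0 pk ts tt; rewrite /generates_transitive.
set G := <<_>>%g.
have sub g x : g \in G -> porbit g x \subset orbit 'P G x.
  move=> gG; apply/subsetP => y /porbitP[i ->].
  by apply/orbitP; exists (g ^+ i)%g => //; rewrite groupX.
have sG : s \in G by rewrite mem_gen // !inE eqxx.
have tG : t \in G by rewrite mem_gen // !inE eqxx orbT.
have : p \in cycle_lengths t by rewrite (perm_mem tt) !inE eqxx.
case/mapP => C1; rewrite mem_enum => /imsetP[x _ ->] pE.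
have xo y : y \in orbit 'P G x -> orbit 'P G y = orbit 'P G x.
  by move=> xy; apply/orbit_eqP.
have [y ys yt] : exists2 y, y \in porbit s x & y \notin porbit t x.
  apply/subsetPn/negP => /subset_leq_card.
  by rewrite (card_porbit_nseq x ts) -pE leqNgt pk.
have yx : y \in orbit 'P G x by apply: (subsetP (sub s x sG)).
apply/imsetP; exists x => //; apply/esym/eqP; rewrite eqEsubset subsetT /=.
apply/subsetP => z _; case: (boolP (z \in porbit t x)) => [|zx].
  exact: (subsetP (sub t x tG)).
case: (boolP (z \in porbit t y)) => [zy|zy].
  by rewrite -(xo y yx); apply: (subsetP (sub t y tG)).
have : (size [:: porbit t x; porbit t y; porbit t z] <= size (enum (porbits t)))%N.
  apply: uniq_leq_size.
    rewrite /= !inE !negb_or !eq_porbit_mem andbT (porbit_sym _ x y) (porbit_sym _ x z).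
    by rewrite yt zx porbit_sym zy.
  by move=> D; rewrite !inE mem_enum => /or3P[] /eqP ->; apply: imset_f.
by rewrite -[X in (_ <= X)%N](size_map (fun C : {set 'I_n} => #|C|)) -/(cycle_lengths t) (perm_size tt).
Qed.

End CycleTypes.

(** The translation i |-> i + d of Z/dk has d cycles, all of length k. *)
Lemma cycle_class_nseq_neq0 d k : (0 < d)%N -> (0 < k)%N ->
  cycle_class (d * k) (nseq d k) != set0.
Proof.
move=> d0 k0; have n0 : (0 < d * k)%N by rewrite muln_gt0 d0.
pose f (i : 'I_(d * k)) : 'I_(d * k) := Ordinal (ltn_pmod (i + d) n0).
have fI : injective f.
  move=> i j /(congr1 val) /= /eqP; rewrite eqn_modDr !modn_small // => /eqP.
  exact: val_inj.
pose s := perm fI.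
have sE (x : 'I_(d * k)) i : iter i s x = ((x + i * d) %% (d * k))%N :> nat.
  elim: i => [|i IH] /=; first by rewrite addn0 modn_small.
  by rewrite permE /= IH modnDml mulSn addnAC addnA.
have itk x : iter k s x = x.
  by apply: ord_inj; rewrite sE [(k * d)%N]mulnC modnDr modn_small.
have ck x : #|porbit s x| = k.
  apply/eqP; rewrite eqn_leq; apply/andP; split.
    rewrite leqNgt; apply/negP => lt.
    have := @nth_uniq _ x _ 0 k _ _ (uniq_traject_porbit s x).
    rewrite !size_traject lt (leq_trans _ lt) // => /(_ isT isT).
    by rewrite !nth_traject ?(leq_trans _ lt) // itk eqxx eq_sym (gtn_eqF k0).
  have := congr1 (@nat_of_ord _) (iter_porbit s x); rewrite sE => E.
  have : (#|porbit s x| * d == 0 %[mod d * k])%N.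
    by rewrite -(eqn_modDl x) addn0 E modn_small.
  rewrite mod0n -/(dvdn _ _) [(#|_| * d)%N]mulnC dvdn_pmul2l // => /dvdn_leq -> //.
  by rewrite lt0n card_porbit_neq0.
apply/set0Pn; exists s; rewrite inE /has_cycle_type.
have ckC C : C \in porbits s -> #|pred_of_set C| = k by case/imsetP => x _ ->.
have -> // : cycle_lengths s = nseq d k.
have /all_pred1P -> : all (pred1 k) (cycle_lengths s).
  by apply/allP => _ /mapP[C + ->]; rewrite mem_enum => /ckC ->; exact: eqxx.
congr nseq; rewrite size_map -cardE.
have := sum_card_porbits s; rewrite (eq_bigr _ ckC) sum_nat_const => /eqP.
by rewrite eqn_pmul2r // => /eqP.
Qed.

(** * The theorem *)

Lemma eq_poly_large (u v : {poly rat}) N :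
  (forall x, (N <= x)%N -> u.[x%:R] = v.[x%:R]) -> u = v.
Proof.
move=> uv; apply/eqP; rewrite -subr_eq0; apply/eqP.
pose rs : seq rat := [seq (N + i)%:R | i <- iota 0 (size (u - v))].
apply: (@roots_geq_poly_eq0 _ _ rs); last by rewrite size_map size_iota.
  apply/allP => _ /mapP[i _ ->]; rewrite rootE hornerD hornerN uv ?leq_addr //.
  by rewrite subrr.
rewrite map_inj_uniq ?iota_uniq // => i j /eqP.
by rewrite eqr_nat eqn_add2l => /eqP.
Qed.

Lemma horner_binom_poly q k (x : rat) M : q.[x] = M%:R ->
  (binom_poly q k).[x] = (M ^_ k)%:R / k`!%:R.
Proof.
move=> qx; rewrite /binom_poly hornerZ mulrC horner_prod; congr (_ / _).
elim: k => [|k IH]; first by rewrite big_ord0.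
rewrite big_ord_recr IH /= hornerD hornerN qx -[k%:R in LHS]polyC_natr hornerC.
rewrite ffactnSr natrM; case: (leqP k M) => kM; first by rewrite natrB.
by rewrite ffact_small // !mul0r.
Qed.

Lemma radial_dop_iter m' k d f : trace_poly f -> trace_poly (dop f (tr_pow m' k ^+ d)) /\
  vdm m'.+1 * comp_mpoly (diag_subst m') (dop f (tr_pow m' k ^+ d)) =
  iter d (dpow k) (vdm m'.+1 * comp_mpoly (diag_subst m') f).
Proof.
move=> fi; elim: d => [|d [IH1 IH2]]; first by rewrite expr0 dop1.
rewrite exprSr dopM; have [H1 H2] := radial_dop k IH1.
by split; rewrite // iterS H2 IH2.
Qed.

Lemma trace_prodE m' n (s : 'S_n) lambda : has_cycle_type s lambda ->
  trace_prod m' s = \prod_(l <- lambda) tr_pow m' l.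
Proof.
by move=> sl; rewrite -(perm_big _ sl) /= big_map big_enum.
Qed.

(** The constant [dop_trace_prod] equals its own restriction to diagonal matrices,
and D is nonzero, so [radial_dop_iter] and [iter_dpow_eval] determine it. *)
Lemma sum_conj_kappa m' d k a p (s g : 'S_(d * k)) :
  (a + p = d * k)%N -> (0 < p)%N -> (p < k)%N ->
  has_cycle_type s (nseq d k) -> has_cycle_type g [:: p; a] ->
  \sum_(u : 'S_(d * k)) (m'.+1%:R : rat) ^+ kappa (s^-1 ^ u * g)%g =
  \sum_(i < p) weight d k a (m'.+1 + i).
Proof.
move=> apE p0 pk ss gg; set K := \sum_(u : _) _.
have gE : trace_prod m' g = tr_pow m' a * tr_pow m' p.
  by rewrite (trace_prodE _ gg) !big_cons big_nil mulr1 mulrC.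
have sE : trace_prod m' s = tr_pow m' k ^+ d.
  by rewrite (trace_prodE _ ss) big_nseq -Monoid.iteropE.
have gi : trace_poly (tr_pow m' a * tr_pow m' p) by apply: trace_polyM; exact: trace_poly_tr_pow.
have [_] := radial_dop_iter k d gi.
rewrite -gE -sE dop_trace_prod gE rhoM !rho_tr_pow.
rewrite [RHS](_ : _ = iter d (dpow k) (powsum m'.+1 a * (powsum m'.+1 p * vdm m'.+1))); last first.
  by congr (iter _ _ _); ring.
rewrite iter_dpow_eval // (_ : \sum_u _ = K%:MP); last first.
  rewrite /K raddf_sum; apply: eq_bigr => u _ /=.
  by rewrite rmorphXn rmorph_nat.
rewrite comp_mpolyC mulrC mul_mpolyC => /eqP.
rewrite -subr_eq0 -scalerBl scaler_eq0 (negPf (vdm_neq0 _)) orbF subr_eq0.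
by move/eqP.
Qed.

Theorem corollary3p6 (p k d : nat) (gamma : 'S_(d * k)) :
  (0 < p)%N -> (p < k)%N -> (1 <= d)%N -> (2 * p <= d * k)%N ->
  gamma \in cycle_class (d * k) [:: p; (d * k - p)%N] ->
  'C(d * k, p)%:R *: Pbullet gamma (nseq d k) =
  \sum_(0 <= i < p) \sum_(0 <= j < d.+1)
    ((-1) ^+ (d - j) * 'C(d, j)%:R) *:
      (binom_poly ('X + i%:R) p *
       binom_poly ('X + i%:R - p%:R + (j * k)%:R) (d * k - p)).
Proof.
move=> p0 pk d1 pn; rewrite inE => gt.
set n := (d * k)%N in gamma gt *; set a := (n - p)%N in gt *.
have pn' : (p <= n)%N by lia.
have apE : (a + p = d * k)%N by rewrite subnK.
pose c := cycle_class n (nseq d k).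
apply: (@eq_poly_large _ _ n.+1) => x nx.
have c0 : (#|c|%:R : rat) != 0.
  by rewrite pnatr_eq0 cards_eq0; apply: cycle_class_nseq_neq0 => //; lia.
have -> : x = x.-1.+1 by lia.
set m' := x.-1.
have nm : (n <= m'.+1)%N by rewrite /m'; lia.
pose S : rat := \sum_(s in c) m'.+1%:R ^+ kappa (s * gamma)%g.
(* For every u, the map s |-> s^-1 ^ u permutes the class c, so the average over
   conjugates of s does not change the sum over c. *)
have SE : n`!%:R * S = #|c|%:R * \sum_(i < p) weight d k a (m'.+1 + i).
  transitivity (\sum_(s in c) \sum_(u : 'S_n) (m'.+1%:R : rat) ^+ kappa (s^-1 ^ u * gamma)%g).
    rewrite exchange_big /= -card_Sn mulr_natl -sumr_const.
    apply: eq_big => [u|u _]; first by rewrite inE.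
    rewrite /S.
    rewrite (reindex_inj (h := fun s : 'S_n => (s^-1 ^ u)%g)) /=.
      by apply: eq_bigl => s; rewrite cycle_class_conjV.
    by move=> s s' /conjg_inj/invg_inj.
  rewrite mulr_natl -sumr_const; apply: eq_bigr => s; rewrite inE => ss.
  exact: sum_conj_kappa.
have -> : ('C(n, p)%:R *: Pbullet gamma (nseq d k)).[m'.+1%:R] =
    'C(n, p)%:R * (#|c|%:R^-1 * S).
  rewrite hornerZ /Pbullet hornerZ horner_sum /S /=; congr (_ * (_ * _)).
  apply: eq_big => [s|s _]; last by rewrite hornerXn.
  rewrite andb_idr // inE => ss.
  exact: generates_transitive_nseq p0 pk ss gt.
have n0 : (n`!%:R : rat) != 0 by rewrite pnatr_eq0 -lt0n fact_gt0.
have fp0 : (p`!%:R : rat) != 0 by rewrite pnatr_eq0 -lt0n fact_gt0.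
have fa0 : (a`!%:R : rat) != 0 by rewrite pnatr_eq0 -lt0n fact_gt0.
have bE : 'C(n, p)%:R = n`!%:R / (p`!%:R * a`!%:R) :> rat.
  by rewrite -(bin_fact pn') !natrM mulfK // mulf_neq0.
have -> : S = #|c|%:R * (\sum_(i < p) weight d k a (m'.+1 + i)) / n`!%:R.
  by rewrite -SE mulrC mulKf.
rewrite bE; set W := \sum_(i < p) _.
transitivity (W / (p`!%:R * a`!%:R)).
  by field; rewrite n0 c0 fp0 fa0.
rewrite big_mkord horner_sum /W mulr_suml; apply: eq_bigr => i _.
rewrite big_mkord horner_sum (weight_large apE p0 pk); last by lia.
rewrite mulr_suml; apply: eq_bigr => j _.
rewrite hornerZ hornerM.
have E1 : ('X + i%:R : {poly rat}).[m'.+1%:R] = (m'.+1 + i)%:R.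
  by rewrite hornerD hornerX -polyC_natr hornerC natrD.
have E2 : ('X + i%:R - p%:R + (j * k)%:R : {poly rat}).[m'.+1%:R] =
    (m'.+1 + i - p + j * k)%:R.
  rewrite natrD natrB; last by lia.
  by rewrite hornerD hornerD E1 hornerN -!polyC_natr !hornerC.
rewrite (horner_binom_poly _ E1) (horner_binom_poly _ E2) /signed_bin natrM.
by field; rewrite fp0 fa0.
Qed.
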